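(* Let $(X,d)$ be a complete metric space, let $\alpha,\beta,\gamma,\delta,\varepsilon,\zeta: X\times X\to\mathbb{R}$, and let $T:X\to X$ be an $(\alpha,\beta,\gamma,\delta,\varepsilon,\zeta)$-weighted generalized pseudocontraction. Suppose that there exists a mapping $\lambda: X\times X\to[0,1]$ such that one of the following holds: (1) $\alpha_\lambda(x,y)+\zeta_\lambda(x,y)+2\min\{\beta_\lambda(x,y),0\}>0$ and $\delta_\lambda(x,y)+\varepsilon_\lambda(x,y)+2\min\{\beta_\lambda(x,y),0\}\ge 0$ for any $x,y\in X$; (2) $\alpha_\lambda(x,y)+\zeta_\lambda(x,y)+2\min\{\beta_\lambda(x,y),0\}\ge 0$ and $\delta_\lambda(x,y)+\varepsilon_\lambda(x,y)+2\min\{\beta_\lambda(x,y),0\}>0$ for any $x,y\in X$; (3) $\alpha_\lambda(x,y)+\varepsilon_\lambda(x,y)+2\min\{\gamma_\lambda(x,y),0\}>0$ and $\delta_\lambda(x,y)+\zeta_\lambda(x,y)+2\min\{\gamma_\lambda(x,y),0\}\ge 0$ for any $x,y\in X$; (4) $\alpha_\lambda(x,y)+\varepsilon_\lambda(x,y)+2\min\{\gamma_\lambda(x,y),0\}\ge 0$ and $\delta_\lambda(x,y)+\zeta_\lambda(x,y)+2\min\{\gamma_\lambda(x,y),0\}>0$ for any $x,y\in X$; (5) there exist $A\in(0,1)$ and $B\in(0,\infty)$ such that for any $x,y\in X$ at least one of the following two alternatives (a), (b) holds: (a) $\alpha_\lambda(x,y)+\zeta_\lambda(x,y)+2\min\{\beta_\lambda(x,y),0\}>0$,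 $$-\frac{\delta_\lambda(x,y)+\varepsilon_\lambda(x,y)+2\min\{\beta_\lambda(x,y),0\}}{\alpha_\lambda(x,y)+\zeta_\lambda(x,y)+2\min\{\beta_\lambda(x,y),0\}}\le A,$$ and $\alpha_\lambda(x,y)+\beta_\lambda(x,y)+\zeta_\lambda(x,y)\ge B$; (b) $\alpha_\lambda(y,x)+\varepsilon_\lambda(y,x)+2\min\{\gamma_\lambda(y,x),0\}>0$, $$-\frac{\delta_\lambda(y,x)+\zeta_\lambda(y,x)+2\min\{\gamma_\lambda(y,x),0\}}{\alpha_\lambda(y,x)+\varepsilon_\lambda(y,x)+2\min\{\gamma_\lambda(y,x),0\}}\le A,$$ and $\alpha_\lambda(y,x)+\gamma_\lambda(y,x)+\varepsilon_\lambda(y,x)\ge B$; and furthermore there exists $M\in(0,\infty)$ such that $|\alpha(x,y)|\le M$, $|\beta(x,y)|\le M$, $|\gamma(x,y)|\le M$, $|\delta(x,y)|\le M$, $|\varepsilon(x,y)|\le M$ and $|\zeta(x,y)|\le M$ for any $x,y\in X$. Then $T$ has a fixed point; namely, for any $x\in X$ the limit $u=\lim_{n\to\infty}T^n x$ exists in $X$ and $u$ is a fixed point of $T$.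
   Context: Metric spaces are taken to be nonempty. Given mappings $\alpha,\beta,\gamma,\delta,\varepsilon,\zeta: X\times X\to\mathbb{R}$ on a metric space $(X,d)$, a mapping $T:X\to X$ is called an $(\alpha,\beta,\gamma,\delta,\varepsilon,\zeta)$-weighted generalized pseudocontraction if for any $x,y\in X$ $$\alpha(x,y)d(Tx,Ty)^2+\beta(x,y)d(x,Ty)^2+\gamma(x,y)d(Tx,y)^2+\delta(x,y)d(x,y)^2+\varepsilon(x,y)d(x,Tx)^2+\zeta(x,y)d(y,Ty)^2\le 0.$$ For $\lambda:X\times X\to[0,1]$ define $$\alpha_\lambda(x,y)=(1-\lambda(x,y))\alpha(x,y)+\lambda(x,y)\alpha(y,x),$$ $$\beta_\lambda(x,y)=(1-\lambda(x,y))\beta(x,y)+\lambda(x,y)\gamma(y,x),$$ $$\gamma_\lambda(x,y)=(1-\lambda(x,y))\gamma(x,y)+\lambda(x,y)\beta(y,x),$$ $$\delta_\lambda(x,y)=(1-\lambda(x,y))\delta(x,y)+\lambda(x,y)\delta(y,x),$$ $$\varepsilon_\lambda(x,y)=(1-\lambda(x,y))\varepsilon(x,y)+\lambda(x,y)\zeta(y,x),$$ $$\zeta_\lambda(x,y)=(1-\lambda(x,y))\zeta(x,y)+\lambda(x,y)\varepsilon(y,x).$$ *)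

(* Defs.v *)
From HB Require Import structures.
From mathcomp Require Import all_boot all_order all_algebra.
From mathcomp Require Import all_classical all_reals topology.

Set Implicit Arguments.
Unset Strict Implicit.
Unset Printing Implicit Defensive.

Import Order.TTheory GRing.Theory Num.Theory.

Local Open Scope classical_set_scope.
Local Open Scope ring_scope.

(* Nonemptiness is the [Pointed] structure contained in [Complete]. *)
#[short(type="completeMetricType")]
HB.structure Definition CompleteMetric (R : numDomainType) :=
  {X of Complete X & PseudoPointedMetric R X & Metric R X}.

Definition weighted_generalized_pseudocontraction (R : realType)
    (X : metricType R) (alpha beta gamma delta epsilon zeta : X -> X -> R)
    (T : X -> X) : Prop :=
  forall x y : X,
    alpha x y * mdist (T x) (T y) ^+ 2
    + beta x y * mdist x (T y) ^+ 2
    + gamma x y * mdist (T x) y ^+ 2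
    + delta x y * mdist x y ^+ 2
    + epsilon x y * mdist x (T x) ^+ 2
    + zeta x y * mdist y (T y) ^+ 2 <= 0.

(* The second weight is evaluated at [(y, x)].  With this operation,
   alpha_lambda = mix lambda alpha alpha, beta_lambda = mix lambda beta gamma,
   gamma_lambda = mix lambda gamma beta, delta_lambda = mix lambda delta delta,
   epsilon_lambda = mix lambda epsilon zeta and
   zeta_lambda = mix lambda zeta epsilon. *)
Definition mix (R : realType) (X : Type) (lambda f g : X -> X -> R) (x y : X)
    : R :=
  (1 - lambda x y) * f x y + lambda x y * g y x.

(* Main.v *)
(* Taking y = T x in the inequality for the mixed weights and bounding d(x, T^2 x)^2 by
   2 d(x, T x)^2 + 2 d(T x, T^2 x)^2 gives
     (al + ze + 2 min(be, 0)) d(T x, T^2 x)^2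
       + (de + ep + 2 min(be, 0)) d(x, T x)^2 <= 0.
   Under (1) and (2) this forces T (T x) = T x; under (5a) it makes the orbit of
   x a geometric Cauchy sequence, and the inequality at (T^n x, u) becomes
   (al + be + ze) d(u, T u)^2 <= o(1) in the limit.  Exchanging the roles of x
   and y turns (3), (4) and (5b) into (1), (2) and (5a). *)
Require Import Defs.
From HB Require Import structures.
From mathcomp Require Import all_boot all_order all_algebra.
From mathcomp Require Import all_classical all_reals topology.
From mathcomp Require Import normedtype sequences.
From mathcomp Require Import ring lra.

Set Implicit Arguments.
Unset Strict Implicit.
Unset Printing Implicit Defensive.

Import Order.TTheory GRing.Theory Num.Theory.
Import numFieldNormedType.Exports.

Local Open Scope classical_set_scope.
Local Open Scope ring_scope.

(** * Symmetry and convex mixing of the weights *)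

Lemma pseudocontraction_swap (R : realType) (X : metricType R)
    (al be ga de ep ze : X -> X -> R) (T : X -> X) :
  weighted_generalized_pseudocontraction al be ga de ep ze T ->
  weighted_generalized_pseudocontraction
    (fun x y => al y x) (fun x y => ga y x) (fun x y => be y x)
    (fun x y => de y x) (fun x y => ze y x) (fun x y => ep y x) T.
Proof.
move=> hT x y; have := hT y x.
rewrite (metric_sym (T y) (T x)) (metric_sym y (T x)) (metric_sym (T y) x).
by rewrite (metric_sym y x); lra.
Qed.

(** The mixed inequality at [(x, y)] is the convex combination, with coefficients [1 - lambda x y]
    and [lambda x y], of the original inequality and its swapped form. *)
Lemma pseudocontraction_mix (R : realType) (X : metricType R)
    (lambda al be ga de ep ze : X -> X -> R) (T : X -> X) :
  (forall x y, 0 <= lambda x y <= 1) ->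
  weighted_generalized_pseudocontraction al be ga de ep ze T ->
  weighted_generalized_pseudocontraction
    (mix lambda al al) (mix lambda be ga) (mix lambda ga be)
    (mix lambda de de) (mix lambda ep ze) (mix lambda ze ep) T.
Proof.
move=> hl hT x y; have /andP[l0 l1] := hl x y.
have {}l1 : 0 <= 1 - lambda x y by rewrite subr_ge0.
have := ler_wpM2l l1 (hT x y).
have := ler_wpM2l l0 (pseudocontraction_swap hT x y).
by rewrite /mix; lra.
Qed.

Lemma mix_bounded (R : realType) (X : Type) (lambda f g : X -> X -> R) (M : R) :
  (forall x y, 0 <= lambda x y <= 1) ->
  (forall x y, `|f x y| <= M) -> (forall x y, `|g x y| <= M) ->
  forall x y, `|mix lambda f g x y| <= M.
Proof.
move=> hl hf hg x y; have /andP[l0 l1] := hl x y.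
move: (hf x y) (hg y x); rewrite !ler_norml /mix => /andP[f1 f2] /andP[g1 g2].
by apply/andP; split; nra.
Qed.

(** * Consecutive distances along an orbit *)

Lemma pseudocontraction_orbit (R : realType) (X : metricType R)
    (al be ga de ep ze : X -> X -> R) (T : X -> X) (x : X) :
  weighted_generalized_pseudocontraction al be ga de ep ze T ->
  (al x (T x) + ze x (T x) + 2 * Num.min (be x (T x)) 0)
    * mdist (T x) (T (T x)) ^+ 2
  + (de x (T x) + ep x (T x) + 2 * Num.min (be x (T x)) 0)
    * mdist x (T x) ^+ 2 <= 0.
Proof.
move=> /(_ x (T x)); rewrite mdistxx.
have := metric_triangle x (T x) (T (T x)).
have := mdist_ge0 x (T x); have := mdist_ge0 (T x) (T (T x)).
have := mdist_ge0 x (T (T x)).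
set p := mdist (T x) _; set q := mdist x (T (T x)); set r := mdist x (T x).
move=> q0 p0 r0 tri.
have qpr : q ^+ 2 <= 2 * p ^+ 2 + 2 * r ^+ 2.
  have : q ^+ 2 <= (r + p) ^+ 2 by rewrite ler_sqr // nnegrE addr_ge0.
  by have := sqr_ge0 (p - r); nra.
have q20 := sqr_ge0 q.
(* Since [m <= 0], multiplying [qpr] by [m] reverses it: [m * (2 p^2 + 2 r^2) <= m * q^2 <= be *
   q^2]. The [ga] term carries [d(T x, T x) = 0]. *)
set m := Num.min _ _.
have m0 : m <= 0 by rewrite /m ge_min lexx orbT.
have mb : m <= be x (T x) by rewrite /m ge_min lexx.
have := ler_wpM2r q20 mb; have := ler_wnM2l m0 qpr.
by lra.
Qed.

(** The ratio bound means [- Q <= A * P], so the orbit inequality gives [P * d(T x, T (T x))^2 <= A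
    * P * d(x, T x)^2], and the positive [P] cancels. *)
Lemma pseudocontraction_orbit_le (R : realType) (X : metricType R)
    (al be ga de ep ze : X -> X -> R) (T : X -> X) (A : R) (x : X) :
  weighted_generalized_pseudocontraction al be ga de ep ze T ->
  let P := al x (T x) + ze x (T x) + 2 * Num.min (be x (T x)) 0 in
  let Q := de x (T x) + ep x (T x) + 2 * Num.min (be x (T x)) 0 in
  0 < P -> - (Q / P) <= A ->
  mdist (T x) (T (T x)) ^+ 2 <= A * mdist x (T x) ^+ 2.
Proof.
move=> hT P Q P0; rewrite -mulNr ler_pdivrMr // => QP.
have := pseudocontraction_orbit x hT; rewrite -/P -/Q => h.
rewrite -(ler_pM2l P0); have := ler_wpM2r (sqr_ge0 (mdist x (T x))) QP.
by lra.
Qed.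

Lemma pseudocontraction_idem (R : realType) (X : metricType R)
    (al be ga de ep ze : X -> X -> R) (T : X -> X) :
  weighted_generalized_pseudocontraction al be ga de ep ze T ->
  let P x y := al x y + ze x y + 2 * Num.min (be x y) 0 in
  let Q x y := de x y + ep x y + 2 * Num.min (be x y) 0 in
  (forall x y, 0 < P x y /\ 0 <= Q x y) \/
  (forall x y, 0 <= P x y /\ 0 < Q x y) ->
  forall x, T (T x) = T x.
Proof.
move=> hT P Q hPQ x.
have := pseudocontraction_orbit x hT.
rewrite -/(P x (T x)) -/(Q x (T x)) => h.
have d1 := sqr_ge0 (mdist x (T x)); have d2 := sqr_ge0 (mdist (T x) (T (T x))).
case: hPQ => /(_ x (T x)) [hP hQ].
- apply/esym/mdist_positivity/eqP; rewrite -sqrf_eq0 eq_le d2 andbT.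
  by rewrite -(pmulr_rle0 _ hP); have := mulr_ge0 hQ d1; lra.
(* With [Q] positive it is [d(x, T x)] that vanishes, so [x] itself is already fixed. *)
- suff Tx : x = T x by rewrite -!Tx.
  apply/mdist_positivity/eqP; rewrite -sqrf_eq0 eq_le d1 andbT.
  by rewrite -(pmulr_rle0 _ hQ); have := mulr_ge0 hP d2; lra.
Qed.

(** * Convergence of orbits with geometrically decreasing steps *)

Lemma geometric_orbit_cvg (R : realType) (X : completeMetricType R)
    (T : X -> X) (s : R) (x : X) :
  0 <= s < 1 ->
  (forall y, mdist (T y) (T (T y)) <= s * mdist y (T y)) ->
  exists u : X, (fun n : nat => iter n T x) @ \oo --> u.
Proof.
move=> /andP[s0 s1] hT; pose z := fun n : nat => iter n T x.
have s10 : 0 < 1 - s by rewrite subr_gt0.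
have step n : mdist (z n) (z n.+1) <= s ^+ n * mdist x (T x).
  elim: n => [|n IH]; first by rewrite expr0 mul1r.
  by rewrite exprS -mulrA (le_trans (hT (z n))) // ler_wpM2l.
(* The geometric sum of the steps from [n] to [n + k], multiplied by [1 - s] to avoid a quotient.
   Bounding [1 - s ^+ k] by 1 later makes it uniform in [k]. *)
have dist_le n k :
    (1 - s) * mdist (z n) (z (n + k)%N)
      <= s ^+ n * mdist x (T x) * (1 - s ^+ k).
  elim: k => [|k IH]; first by rewrite addn0 mdistxx expr0 subrr !mulr0.
  rewrite addnS (le_trans (ler_wpM2l (ltW s10) (metric_triangle _ (z (n + k)%N) _))) //.
  have := ler_wpM2l (ltW s10) (step (n + k)%N).
  by rewrite exprD exprS; lra.
suff /cauchy_cvgP : cauchy (z @ \oo) by move=> ?; exists (lim (z @ \oo)).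
apply: cauchy_exP => e e0.
have [N _ hN] : \forall n \near \oo, s ^+ n * mdist x (T x) < (1 - s) * e.
  have sn1 : `|s| < 1 by rewrite ger0_norm.
  have /cvgr_lt/(_ ((1 - s) * e)) := cvg_geometric (mdist x (T x)) sn1.
  by under eq_near do rewrite /geometric /= mulrC; apply; rewrite mulr_gt0.
exists (z N); exists N => // n /= Nn; rewrite ballEmdist /=.
rewrite -(ltr_pM2l s10) -(subnKC Nn) (le_lt_trans (dist_le _ _)) //.
apply: le_lt_trans (hN N (leqnn N)).
by rewrite ler_piMr ?mulr_ge0 ?exprn_ge0 ?mdist_ge0 // gerBl exprn_ge0.
Qed.

(** * The inequality near the limit of an orbit *)

(** Replacing [p^2] and [q^2] by [D^2] costs at most [M * e * (1 + 2 * D)] each; the terms in [r],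
    [s], [t] cost at most [M * e], [M * e] and [4 * M * e]. The total is [e * (M * (8 + 4 * D))]. *)
Lemma limit_inequality (R : realType) (al be ga de ep ze M B e p q r s t D : R) :
  al * p ^+ 2 + be * q ^+ 2 + ga * r ^+ 2 + de * s ^+ 2 + ep * t ^+ 2
    + ze * D ^+ 2 <= 0 ->
  [/\ `|al| <= M, `|be| <= M, `|ga| <= M, `|de| <= M & `|ep| <= M] ->
  B <= al + be + ze -> 0 <= e <= 1 -> 0 <= D ->
  `|p - D| <= e -> `|q - D| <= e -> 0 <= r <= e -> 0 <= s <= e ->
  0 <= t <= 2 * e ->
  B * D ^+ 2 <= e * (M * (8 + 4 * D)).
Proof.
move=> h [hal hbe hga hde hep] hB /andP[e0 e1] D0 pD qD /andP[r0 re]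
  /andP[s0 se] /andP[t0 te].
have prod_le (a b c : R) : `|a| <= M -> `|b| <= c -> - (M * c) <= a * b.
  move=> aM bc; have : `|a * b| <= M * c by rewrite normrM ler_pM.
  by rewrite ler_norml => /andP[].
(* Factor [y^2 - D^2] and use [|y + D| <= e + 2 * D <= 1 + 2 * D]. *)
have sqr_near (y : R) : `|y - D| <= e -> `|y ^+ 2 - D ^+ 2| <= e * (1 + 2 * D).
  move=> yD; rewrite subr_sqr normrM ler_pM //.
  have -> : y + D = (y - D) + 2 * D by ring.
  rewrite (le_trans (ler_normD _ _)) // lerD ?(le_trans yD) //.
  by rewrite ger0_norm // mulr_ge0.
have sqr_small (y c : R) : 0 <= y <= c * e -> 0 <= c -> `|y ^+ 2| <= c ^+ 2 * e.
  move=> /andP[y0 ye] c0; rewrite ger0_norm ?sqr_ge0 //.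
  apply: (@le_trans _ _ ((c * e) ^+ 2)).
    by rewrite ler_sqr // nnegrE // mulr_ge0.
  by rewrite exprMn ler_wpM2l ?sqr_ge0 // expr2 ler_piMr.
have hr : `|r ^+ 2| <= 1 ^+ 2 * e by apply: sqr_small; rewrite // mul1r r0.
have hs : `|s ^+ 2| <= 1 ^+ 2 * e by apply: sqr_small; rewrite // mul1r s0.
have ht : `|t ^+ 2| <= 2 ^+ 2 * e by apply: sqr_small; rewrite // t0.
have := prod_le _ _ _ hal (sqr_near p pD).
have := prod_le _ _ _ hbe (sqr_near q qD).
have := prod_le _ _ _ hga hr; have := prod_le _ _ _ hde hs.
have := prod_le _ _ _ hep ht.
by have := ler_wpM2r (sqr_ge0 D) hB; lra.
Qed.

Lemma mdist_sub_le (R : realFieldType) (X : metricType R) (x y z : X) :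
  `|mdist x z - mdist y z| <= mdist x y.
Proof.
have := metric_triangle x y z; have := metric_triangle y x z.
by rewrite (metric_sym y x) ler_norml => h1 h2; apply/andP; split; lra.
Qed.

(** Meant for an orbit point [x], where [x] and [T x] are both near [u]: then [d(x, T x) <= 2 * e],
    and [d(T x, T u)] and [d(x, T u)] are within [e] of [d(u, T u)]. *)
Lemma pseudocontraction_limit (R : realType) (X : metricType R)
    (al be ga de ep ze : X -> X -> R) (T : X -> X) (M B e : R) (x u : X) :
  weighted_generalized_pseudocontraction al be ga de ep ze T ->
  [/\ `|al x u| <= M, `|be x u| <= M, `|ga x u| <= M, `|de x u| <= M
    & `|ep x u| <= M] ->
  B <= al x u + be x u + ze x u -> e <= 1 ->
  mdist x u <= e -> mdist (T x) u <= e ->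
  B * mdist u (T u) ^+ 2 <= e * (M * (8 + 4 * mdist u (T u))).
Proof.
move=> hT hM hB e1 xu Txu.
apply: limit_inequality (hT x u) hM hB _ _ _ _ _ _ _; rewrite ?mdist_ge0 //.
- by rewrite (le_trans (mdist_ge0 x u)).
- exact: le_trans (mdist_sub_le _ _ _) Txu.
- exact: le_trans (mdist_sub_le _ _ _) xu.
- rewrite (le_trans (metric_triangle x u (T x))) // (metric_sym u (T x)).
  by lra.
Qed.

Unset Implicit Arguments.

Theorem theorem2p3 (R : realType) (X : completeMetricType R)
    (alpha beta gamma delta epsilon zeta : X -> X -> R) (T : X -> X)
    (hT : weighted_generalized_pseudocontraction
            alpha beta gamma delta epsilon zeta T)
    (hlambda : exists lambda : X -> X -> R,
      (forall x y : X, 0 <= lambda x y <= 1) /\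
      let al := mix lambda alpha alpha in
      let be := mix lambda beta gamma in
      let ga := mix lambda gamma beta in
      let de := mix lambda delta delta in
      let ep := mix lambda epsilon zeta in
      let ze := mix lambda zeta epsilon in
      (* (1) *)
      (forall x y : X,
         0 < al x y + ze x y + 2 * Num.min (be x y) 0 /\
         0 <= de x y + ep x y + 2 * Num.min (be x y) 0)
      \/
      (* (2) *)
      (forall x y : X,
         0 <= al x y + ze x y + 2 * Num.min (be x y) 0 /\
         0 < de x y + ep x y + 2 * Num.min (be x y) 0)
      \/
      (* (3) *)
      (forall x y : X,
         0 < al x y + ep x y + 2 * Num.min (ga x y) 0 /\
         0 <= de x y + ze x y + 2 * Num.min (ga x y) 0)
      \/
      (* (4) *)
      (forall x y : X,
         0 <= al x y + ep x y + 2 * Num.min (ga x y) 0 /\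
         0 < de x y + ze x y + 2 * Num.min (ga x y) 0)
      \/
      (* (5) *)
      ((exists A B : R, 0 < A < 1 /\ 0 < B /\
          forall x y : X,
            [/\ 0 < al x y + ze x y + 2 * Num.min (be x y) 0,
                - ((de x y + ep x y + 2 * Num.min (be x y) 0)
                   / (al x y + ze x y + 2 * Num.min (be x y) 0)) <= A
              & B <= al x y + be x y + ze x y]
            \/
            [/\ 0 < al y x + ep y x + 2 * Num.min (ga y x) 0,
                - ((de y x + ze y x + 2 * Num.min (ga y x) 0)
                   / (al y x + ep y x + 2 * Num.min (ga y x) 0)) <= A
              & B <= al y x + ga y x + ep y x])
       /\
       (exists M : R, 0 < M /\
          forall x y : X,
            `|alpha x y| <= M /\ `|beta x y| <= M /\ `|gamma x y| <= M /\
            `|delta x y| <= M /\ `|epsilon x y| <= M /\ `|zeta x y| <= M))) :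
  (exists u : X, T u = u) /\
  (forall x : X, exists u : X,
     (fun n : nat => iter n T x) @ \oo --> u /\ T u = u).
Proof.
(* Nonemptiness enters here: the orbit of [point] supplies the fixed point. *)
suff orbit_cvg : forall x : X, exists u : X,
    (fun n : nat => iter n T x) @ \oo --> u /\ T u = u.
  by split=> //; have [u [_ Tu]] := orbit_cvg point; exists u.
case: hlambda => lambda [hl]; cbv zeta.
have := pseudocontraction_mix hl hT.
set al := mix lambda alpha alpha; set be := mix lambda beta gamma.
set ga := mix lambda gamma beta; set de := mix lambda delta delta.
set ep := mix lambda epsilon zeta; set ze := mix lambda zeta epsilon.
move=> hW; have hW' := pseudocontraction_swap hW.
have idem_cvg : (forall x, T (T x) = T x) -> forall x : X, exists u : X,
    (fun n : nat => iter n T x) @ \oo --> u /\ T u = u.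
  move=> TT x; exists (T x); split => //.
  (* The orbit is constant from index 1 on; index 0 may differ. *)
  apply: cvg_near_cst; exists 1%N => // -[//|n] _ /=.
  by elim: n => // n IH; rewrite iterS IH TT.
case=> [h1|[h2|[h3|[h4|[[A [B [/andP[A0 A1] [B0 h5]]]] [M [M0 hM]]]]]]].
- by apply: idem_cvg; apply: (pseudocontraction_idem hW); left.
- by apply: idem_cvg; apply: (pseudocontraction_idem hW); right.
- apply: idem_cvg; apply: (pseudocontraction_idem hW').
  by left=> x y; exact: h3.
- apply: idem_cvg; apply: (pseudocontraction_idem hW').
  by right=> x y; exact: h4.
move=> x.
(* Alternative (b) at [(y, T y)] is (a) for the swapped weights at the same pair, so the bound holds
   whichever alternative occurs at each [y]. The root of [A] appears because the estimate concerns
   squared distances. *)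
have step y : mdist (T y) (T (T y)) <= Num.sqrt A * mdist y (T y).
  rewrite -ler_sqr ?nnegrE ?mulr_ge0 ?sqrtr_ge0 ?mdist_ge0 //.
  rewrite exprMn sqr_sqrtr ?(ltW A0) //.
  by case: (h5 y (T y)) => -[P0 QA _];
    [exact: (pseudocontraction_orbit_le hW P0 QA)
    |exact: (pseudocontraction_orbit_le hW' P0 QA)].
have [|u xu] := geometric_orbit_cvg x _ step.
  by rewrite sqrtr_ge0 -sqrtr1 ltr_sqrt.
exists u; split => //.
have [Mal Mbe Mga Mde [Mep Mze]] : [/\ forall y z, `|al y z| <= M,
    forall y z, `|be y z| <= M, forall y z, `|ga y z| <= M,
    forall y z, `|de y z| <= M & (forall y z, `|ep y z| <= M) /\
    forall y z, `|ze y z| <= M].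
  by split; [| | | |split]; apply: mix_bounded => // y z; have := hM y z; tauto.
set K := M * (8 + 4 * mdist u (T u)).
have K0 : 0 < K by rewrite mulr_gt0 // ltr_wpDr ?mulr_ge0 ?mdist_ge0.
have small e : 0 < e -> e <= 1 -> B * mdist u (T u) ^+ 2 <= e * K.
  move=> e0 e1.
  have [N _ hN] : \forall n \near \oo, mdist (iter n T x) u < e.
    have /cvg_ballP/(_ _ e0) := xu; apply: filterS => n.
    by rewrite ballEmdist /= metric_sym.
  (* Both [T^N x] and its image [T^(N+1) x] must be close to [u]. *)
  have dN := ltW (hN N (leqnn N)); have dSN := ltW (hN N.+1 (leqnSn N)).
  (* The alternative may change with [N], but both lead to the same bound, so no subsequence has to
     be extracted. *)
  case: (h5 (iter N T x) u) => -[_ _ hB].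
  - by apply: pseudocontraction_limit hW _ hB e1 dN dSN; split.
  - by apply: pseudocontraction_limit hW' _ hB e1 dN dSN; split.
apply/esym/mdist_positivity/eqP; rewrite -sqrf_eq0 eq_le sqr_ge0 andbT.
rewrite -(pmulr_rle0 _ B0); apply/ler_addgt0Pl => e e0; rewrite addr0.
(* The entry 1 meets the requirement [e <= 1] of [small]; the entry [e / K] makes the product with
   [K] at most [e]. *)
have m0 : 0 < Num.min 1 (e / K) by rewrite lt_min ltr01 divr_gt0.
rewrite (le_trans (small _ m0 _)) ?ge_min ?lexx //.
by rewrite -ler_pdivlMr // ge_min lexx orbT.
Qed.
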